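(* Let $A$ be any real $d\times d$ matrix, and let $$E^f=\lim_{n\to\infty}\left[(A^n)^TA^n\right]^{1/(2n)},\qquad E^b=\lim_{n\to\infty}\left[A^n(A^n)^T\right]^{1/(2n)} .$$ Then for any $\alpha\ge0$ the corresponding $\alpha$-eigenspaces of $E^f$ and $A$ are the same, i.e. $\mathcal{E}^\alpha(E^f)=\mathcal{E}^\alpha(A)$. Equivalently, $\mathcal{E}^\alpha(E^b)=\mathcal{E}^\alpha(A^T)$.
   Context: The limits defining $E^f$ and $E^b$ exist (Oseledets' theorem). The underlying scalar product on $\mathbb{R}^d$ is the canonical one. $\alpha$-eigenspace: the real span of a complex vector $\mathbf{u}+i\mathbf{v}$ ($\mathbf{u},\mathbf{v}\in\mathbb{R}^d$) is $\{\alpha\mathbf{u}+\beta\mathbf{v}:\alpha,\beta\in\mathbb{R}\}$. For a square matrix $Z$, $\mathcal{E}^\alpha(Z)$ is the real span of the generalized eigenvectors of $Z$ corresponding to eigenvalues $\lambda$ with $|\lambda|<\alpha$ (for $\alpha=0$ this is $\{0\}$). *)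

(* Defs.v *)
From mathcomp Require Import all_boot all_order all_algebra.
From mathcomp Require Import complex.
From mathcomp Require Import all_classical all_reals all_analysis.

Set Implicit Arguments.
Unset Strict Implicit.
Unset Printing Implicit Defensive.

Import Order.TTheory GRing.Theory Num.Theory.
Import numFieldNormedType.Exports.

Local Open Scope classical_set_scope.
Local Open Scope ring_scope.
Local Open Scope complex_scope.

(* Matrices act on column vectors throughout, the scalar product on R^d is
   x^T *m y, and 'M[R]_d carries the library's (entrywise) topology. *)

Definition psdmx (R : realType) (d : nat) (S : 'M[R]_d) : Prop :=
  S^T = S /\ forall x : 'cV[R]_d, 0 <= (x^T *m S *m x) 0 0.

(* M^{1/k}: for M positive semidefinite and 0 < k this is the unique positive
   semidefinite S with S^k = M. *)
Definition psd_root (R : realType) (d k : nat) (M : 'M[R]_d) : 'M[R]_d :=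
  get [set S : 'M[R]_d | psdmx S /\ S ^+ k = M].

(* The limits below exist by Oseledets' theorem; the term n = 0, where the
   exponent 1/(2n) is meaningless, does not affect them. *)
Definition Ef (R : realType) (d : nat) (A : 'M[R]_d) : 'M[R]_d :=
  lim ((fun n : nat => psd_root (2 * n) ((A ^+ n)^T *m A ^+ n)) @ \oo).

Definition Eb (R : realType) (d : nat) (A : 'M[R]_d) : 'M[R]_d :=
  lim ((fun n : nat => psd_root (2 * n) (A ^+ n *m (A ^+ n)^T)) @ \oo).

(* The library's geigenspace is about row vectors (left action), hence the
   explicit form. Since w != 0, such an l is necessarily an eigenvalue of Z. *)
Definition gen_eigenvector (R : realType) (d : nat) (Z : 'M[R]_d)
    (l : R[i]) (w : 'cV[R[i]]_d) : Prop :=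
  w != 0 /\
  exists k : nat, (map_mx (real_complex R) Z - l%:M) ^+ k *m w = 0.

(* The real span of a single complex vector u + iv is the set of all
   a u + b v; that of a set W of complex vectors is the sum of those of its
   members. *)
Definition real_span (R : realType) (d : nat) (W : set 'cV[R[i]]_d) :
    set 'cV[R]_d :=
  [set x | exists (m : nat) (w : 'I_m -> 'cV[R[i]]_d) (a b : 'I_m -> R),
    (forall j, W (w j)) /\
    x = \sum_(j < m) (a j *: map_mx (@complex.Re R) (w j)
                      + b j *: map_mx (@complex.Im R) (w j))].

Definition alpha_eigenspace (R : realType) (d : nat) (alpha : R)
    (Z : 'M[R]_d) : set 'cV[R]_d :=
  real_span [set w | exists l : R[i],
    `|l| < alpha%:C /\ gen_eigenvector Z l w].

(* Main.v *)
Require Import Defs.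
From mathcomp Require Import all_boot all_order all_algebra.
From mathcomp Require Import complex.
From mathcomp Require Import all_classical all_reals all_analysis.
From mathcomp Require Import ring lra.

(* Measure growth by |x|^2 and let S_n be the 2n-th root of (A^n)^T A^n, so that
   |S_n^n x| = |A^n x|.  Two descriptions of the alpha-eigenspace of any Z hold:
   it is the set of x with |Z^k x| = O(r^k) for some r < alpha, and it is the
   annihilator of the y with |<y, x>| r^k = O(|Z^k x|) uniformly in x for every
   r < alpha (split the characteristic polynomial over C according to the
   modulus of its roots).  Since k |-> |S_n^k x|^2 is log-convex for symmetric
   S_n, both bounds on A^n interpolate to bounds on S_n^k for k <= n, uniform in
   n, and hence pass to every limit point T of the S_n.  So T and A have the same
   growth spaces for all alpha > 0.  A positive semidefinite matrix is determined
   by its growth spaces, so the bounded sequence S_n has a single limit point,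
   that is, it converges. *)

Set Implicit Arguments.
Unset Strict Implicit.
Unset Printing Implicit Defensive.

Import Order.TTheory GRing.Theory Num.Theory.
Import numFieldNormedType.Exports.
Import Normc.

Local Open Scope classical_set_scope.
Local Open Scope ring_scope.
Local Open Scope complex_scope.

(** * Interpolation for powers of symmetric matrices *)

Section Euclidean.
Variables (R : realFieldType) (d : nat).
Implicit Types x y : 'cV[R]_d.

Definition dotv x y : R := (x^T *m y) 0 0.
Definition nsq x : R := dotv x x.

Lemma dotvE x y : dotv x y = \sum_i x i 0 * y i 0.
Proof. by rewrite /dotv mxE; apply: eq_bigr => i _; rewrite mxE. Qed.

Lemma dotvC x y : dotv x y = dotv y x.
Proof. by rewrite !dotvE; apply: eq_bigr => i _; rewrite mulrC. Qed.

Lemma dotv_mulmx (M : 'M[R]_d) x y : dotv (M *m x) y = dotv x (M^T *m y).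
Proof. by rewrite /dotv trmx_mul mulmxA. Qed.

Lemma dotvDl x1 x2 y : dotv (x1 + x2) y = dotv x1 y + dotv x2 y.
Proof. by rewrite /dotv linearD mulmxDl mxE. Qed.

Lemma dotvZl a x y : dotv (a *: x) y = a * dotv x y.
Proof. by rewrite /dotv linearZ -scalemxAl mxE. Qed.

Lemma nsqE x : nsq x = \sum_i x i 0 ^+ 2.
Proof. by rewrite /nsq dotvE; apply: eq_bigr => i _; rewrite expr2. Qed.

Lemma nsq_ge0 x : 0 <= nsq x.
Proof. by rewrite nsqE sumr_ge0 // => i _; rewrite sqr_ge0. Qed.

Lemma sqr_entry_le_nsq x i : x i 0 ^+ 2 <= nsq x.
Proof.
by rewrite nsqE (bigD1 i) //= lerDl sumr_ge0 // => j _; rewrite sqr_ge0.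
Qed.

Lemma nsq_eq0 x : nsq x = 0 -> x = 0.
Proof.
move=> x0; apply/colP => i; rewrite mxE; apply/eqP.
by rewrite -sqrf_eq0 eq_le sqr_ge0 andbT -x0 sqr_entry_le_nsq.
Qed.

Lemma nsqD x y : nsq (x + y) = nsq x + 2 * dotv x y + nsq y.
Proof.
rewrite /nsq dotvDl [dotv x (x + y)]dotvC [dotv y (x + y)]dotvC !dotvDl.
by rewrite [dotv y x]dotvC; ring.
Qed.

Lemma nsqZ a x : nsq (a *: x) = a ^+ 2 * nsq x.
Proof. by rewrite /nsq dotvZl dotvC dotvZl mulrA expr2. Qed.

Lemma nsqD_le x y : nsq (x + y) <= 2 * nsq x + 2 * nsq y.
Proof.
have := nsq_ge0 (x + (-1) *: y).
rewrite !nsqD nsqZ [dotv x (_ *: _)]dotvC dotvZl [dotv y x]dotvC; lra.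
Qed.

Lemma cauchy_schwarz x y : dotv x y ^+ 2 <= nsq x * nsq y.
Proof.
have [y0|y0] := eqVneq (nsq y) 0.
  have -> : dotv x y = 0 by rewrite (nsq_eq0 y0) /dotv mulmx0 mxE.
  by rewrite expr0n mulr_ge0 ?nsq_ge0.
have yp : 0 < nsq y by rewrite lt_def y0 nsq_ge0.
(* After multiplication by [nsq y], the difference of the two sides is the squared norm of |y|^2 x -
   <x, y> y. *)
rewrite -(ler_pM2r yp) -subr_ge0.
have := nsq_ge0 (nsq y *: x + (- dotv x y) *: y).
rewrite nsqD !nsqZ dotvZl [dotv x (_ *: _)]dotvC dotvZl [dotv y x]dotvC.
by move/le_trans; apply; rewrite le_eqVlt; apply/orP; left; apply/eqP; ring.
Qed.

(** The constant is the squared Frobenius norm; Cauchy-Schwarz is applied to each row. *)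
Lemma nsq_mulmx_le (A : 'M[R]_d) :
  exists2 F : R, 0 <= F & forall x, nsq (A *m x) <= F * nsq x.
Proof.
exists (\sum_i nsq (row i A)^T); first by rewrite sumr_ge0 // => i _; exact: nsq_ge0.
move=> x; rewrite nsqE mulr_suml; apply: ler_sum => i _.
apply: le_trans (cauchy_schwarz _ _); rewrite le_eqVlt; apply/orP; left.
by rewrite /dotv trmxK -row_mul !mxE.
Qed.

End Euclidean.

Lemma ler_exprn_sqr (R : realDomainType) (a b : R) k : 0 <= a -> a <= b ->
  (a ^+ k) ^+ 2 <= (b ^+ k) ^+ 2.
Proof.
move=> a0 ab; have b0 := le_trans a0 ab.
by rewrite -!exprM; apply: lerXn2r; rewrite ?nnegrE.
Qed.

(* A log-convex sequence, once it increases, increases forever. *)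
Lemma logconvex_max (R : realFieldType) (b : nat -> R) (K : R) (n k : nat) :
  (forall j, 0 <= b j) -> (forall j, b j.+1 ^+ 2 <= b j * b j.+2) ->
  b 0%N <= K -> b n <= K -> (k <= n)%N -> b k <= K.
Proof.
move=> b0 bc bK0 bKn kn; rewrite leNgt; apply/negP => bKk.
(* At the least index exceeding [K] the sequence has just increased, its predecessor being at most
   [K]; from there on it never comes back. *)
have [j0 bj0 minj] : exists2 j, K < b j & forall i, K < b i -> (j <= i)%N.
  have P : exists j, K < b j by exists k.
  by exists (ex_minn P); case: ex_minnP.
have K0 : 0 <= K by apply: le_trans bK0.
case: j0 bj0 minj => [|j] bj minj; first by move: bj; rewrite ltNge bK0.
have bjK : b j <= K by rewrite leNgt; apply/negP => /minj; rewrite ltnn.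
have up i : K < b (j + i).+1 /\ b (j + i)%N <= b (j + i).+1.
  elim: i => [|i [IH1 IH2]]; first by rewrite addn0; split=> //; apply/ltW/(le_lt_trans bjK).
  rewrite addnS.
  suff h : b (j + i).+1 <= b (j + i).+2 by split=> //; apply: lt_le_trans h.
  have p : 0 < b (j + i).+1 by apply: le_lt_trans IH1.
  rewrite -(ler_pM2l p) -expr2; apply: le_trans (bc _) _.
  exact: ler_wpM2r.
have jk : (j.+1 <= n)%N by apply: leq_trans kn; exact: minj.
have [] := up (n - j.+1)%N.
by rewrite -addSn subnKC // ltNge bKn.
Qed.

Section SymmetricPowers.
Variables (R : realFieldType) (d : nat).
Implicit Types (S : 'M[R]_d) (x : 'cV[R]_d).

Lemma trmxX S k : (S ^+ k)^T = S^T ^+ k.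
Proof. by elim: k => [|k IH]; rewrite ?expr0 ?trmx1 // exprS exprSr trmx_mul IH. Qed.

Lemma powmx_mulmx S j k (x : 'cV[R]_d) : S ^+ j *m (S ^+ k *m x) = S ^+ (j + k) *m x.
Proof. by rewrite exprD mulmxA. Qed.

Lemma dotv_sym_pow S x y j k : S^T = S ->
  dotv (S ^+ (j + k) *m x) y = dotv (S ^+ j *m x) (S ^+ k *m y).
Proof.
by move=> Ss; rewrite addnC exprD -mulmxA dotv_mulmx trmxX Ss.
Qed.

(** By symmetry |S^(k+1) x|^2 = <S^k x, S^(k+2) x>; then Cauchy-Schwarz. *)
Lemma nsq_pow_logconvex S x k : S^T = S ->
  nsq (S ^+ k.+1 *m x) ^+ 2 <= nsq (S ^+ k *m x) * nsq (S ^+ k.+2 *m x).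
Proof.
move=> Ss; apply: le_trans (cauchy_schwarz _ _).
have := dotv_sym_pow x (S ^+ k.+1 *m x) k 1 Ss.
by rewrite addn1 powmx_mulmx add1n /nsq => ->.
Qed.

(** Dividing |S^j x|^2 by r^(2j) preserves log-convexity, so [logconvex_max] applies to the
    quotient. *)
Lemma nsq_pow_max S x (r K : R) n k : S^T = S -> 0 < r ->
  nsq x <= K -> nsq (S ^+ n *m x) <= K * (r ^+ n) ^+ 2 -> (k <= n)%N ->
  nsq (S ^+ k *m x) <= K * (r ^+ k) ^+ 2.
Proof.
move=> Ss r0 xK SK kn.
have rp j : 0 < (r ^+ j) ^+ 2 by rewrite !exprn_gt0.
rewrite -ler_pdivrMr //.
apply: (logconvex_max (b := fun j => nsq (S ^+ j *m x) / (r ^+ j) ^+ 2) _ _ _ _ kn).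
- by move=> j; rewrite divr_ge0 ?nsq_ge0 ?ltW.
- move=> j; rewrite expr_div_n mulrACA -invfM ler_pdivrMr ?exprn_gt0 //.
  apply: le_trans (nsq_pow_logconvex _ _ Ss) _.
  rewrite le_eqVlt; apply/orP; left; apply/eqP.
  by rewrite !exprS; field; rewrite expf_neq0 ?gt_eqF.
- by rewrite expr0 expr0 expr1n divr1 mul1mx.
- by rewrite ler_pdivrMr.
Qed.

End SymmetricPowers.

(** * Transfer of bounds from A^n to the powers of its root *)

Section PsdRoot.
Variables (R : realFieldType) (d : nat).
Variables (A S : 'M[R]_d) (n : nat).
Hypotheses (Ss : S^T = S) (SA : S ^+ (2 * n) = (A ^+ n)^T *m A ^+ n).

Lemma nsq_root (x : 'cV[R]_d) : nsq (S ^+ n *m x) = nsq (A ^+ n *m x).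
Proof.
rewrite /nsq -dotv_sym_pow // addnn -mul2n SA -mulmxA dotv_mulmx.
by rewrite trmxK.
Qed.

(** Interpolates between exponents 0 and n; the constant does not depend on n, so it survives a
    limit in n. *)
Lemma root_upper_bound (x : 'cV[R]_d) (r C : R) k : 0 < r -> (k <= n)%N ->
  nsq (A ^+ n *m x) <= C * (r ^+ n) ^+ 2 ->
  nsq (S ^+ k *m x) <= Num.max (nsq x) C * (r ^+ k) ^+ 2.
Proof.
move=> r0 kn xC; apply: nsq_pow_max kn => //; first by rewrite le_max lexx.
rewrite nsq_root; apply: le_trans xC _.
by rewrite ler_wpM2r ?sqr_ge0 // le_max lexx orbT.
Qed.

(* The hypothesis says that y y^T is dominated by S^(2n); hence y = S^n z with
   z small, and log-convexity interpolates between z and y. *)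
Lemma root_lower_bound (y x : 'cV[R]_d) (r C : R) k : 0 < r -> (k <= n)%N ->
  (forall x, dotv y x ^+ 2 * (r ^+ n) ^+ 2 <= C * nsq (A ^+ n *m x)) ->
  dotv y x ^+ 2 * (r ^+ k) ^+ 2 <= Num.max (nsq y) C * nsq (S ^+ k *m x).
Proof.
move=> r0 kn yC; set K := Num.max _ _.
have rp j : 0 < (r ^+ j) ^+ 2 by rewrite !exprn_gt0.
have nS2 (u : 'cV[R]_d) : S ^+ (2 * n) *m u = S ^+ n *m (S ^+ n *m u).
  by rewrite powmx_mulmx addnn mul2n.
(* A vector u killed by S^(2n) has A^n u = 0, so the hypothesis gives <y, u> = 0: y is orthogonal to
   the kernel of S^(2n), hence lies in its range. *)
have : (y^T <= S ^+ (2 * n))%MS.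
  rewrite submxE; apply/eqP/rowP => j; rewrite [RHS]mxE.
  have Sc : S ^+ (2 * n) *m col j (cokermx (S ^+ (2 * n))) = 0.
    by rewrite colE mulmxA mulmx_coker mul0mx.
  have : dotv y (col j (cokermx (S ^+ (2 * n)))) ^+ 2 * (r ^+ n) ^+ 2 <= 0.
    apply: le_trans (yC _) _; rewrite -nsq_root {1}/nsq -dotv_sym_pow // addnn -mul2n.
    by rewrite Sc /dotv trmx0 mul0mx mxE mulr0.
  rewrite pmulr_lle0 // => h.
  have /eqP : dotv y (col j (cokermx (S ^+ (2 * n)))) ^+ 2 == 0.
    by rewrite eq_le h sqr_ge0.
  by move/eqP; rewrite sqrf_eq0 /dotv colE mulmxA -colE mxE => /eqP.
case/submxP => D yD.
set z := S ^+ n *m D^T.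
have yz : y = S ^+ n *m z by rewrite -nS2 -[y]trmxK yD trmx_mul trmxX Ss.
(* The hypothesis at x = D^T reads |z|^4 r^(2n) <= C |z|^2. *)
have zK : nsq z * (r ^+ n) ^+ 2 <= K.
  have [z0|z0] := eqVneq (nsq z) 0.
    by rewrite z0 mul0r le_max nsq_ge0.
  have zp : 0 < nsq z by rewrite lt_def z0 nsq_ge0.
  rewrite -(ler_pM2l zp); have := yC D^T.
  rewrite -nsq_root -/z.
  have -> : dotv y D^T = nsq z by rewrite yz dotv_mulmx trmxX Ss.
  move=> h; apply: (@le_trans _ _ (C * nsq z)).
    by apply: le_trans h; rewrite mulrA expr2.
  by rewrite mulrC ler_wpM2l ?nsq_ge0 // le_max lexx orbT.
(* Interpolation between |z|^2 <= K / r^(2n) at exponent 0 and |S^n z|^2 = |y|^2 <= K at exponent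
   n. *)
have zk : nsq (S ^+ (n - k) *m z) * (r ^+ k) ^+ 2 <= K.
  have := @nsq_pow_max _ _ S z r (K / (r ^+ n) ^+ 2) n (n - k)%N Ss r0.
  rewrite ler_pdivlMr // zK -yz divfK ?gt_eqF // le_max lexx leq_subr.
  move=> /(_ isT isT isT); rewrite -(ler_pM2r (rp k)) => /le_trans; apply.
  have rnk : (r ^+ n) = r ^+ (n - k) * r ^+ k by rewrite -exprD subnK.
  rewrite le_eqVlt; apply/orP; left; apply/eqP; rewrite rnk.
  by field; rewrite !expf_neq0 ?gt_eqF.
have -> : dotv y x = dotv (S ^+ (n - k) *m z) (S ^+ k *m x).
  by rewrite -dotv_sym_pow // subnK // -yz.
apply: (@le_trans _ _ (nsq (S ^+ (n - k) *m z) * nsq (S ^+ k *m x) * (r ^+ k) ^+ 2)).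
  by rewrite ler_wpM2r ?sqr_ge0 // cauchy_schwarz.
by rewrite mulrAC ler_wpM2r ?nsq_ge0.
Qed.
End PsdRoot.

(** * Real spectral theorem and positive semidefinite roots *)

Section RealImaginary.
Variable R : rcfType.
Local Notation toC := (map_mx (real_complex R)).
Local Notation reM := (map_mx (@complex.Re R)).
Local Notation imM := (map_mx (@complex.Im R)).

Lemma ReD (z w : R[i]) : complex.Re (z + w) = complex.Re z + complex.Re w.
Proof. by case: z; case: w. Qed.
Lemma ImD (z w : R[i]) : complex.Im (z + w) = complex.Im z + complex.Im w.
Proof. by case: z; case: w. Qed.
Lemma ReMr (z : R[i]) (a : R) : complex.Re (z * a%:C) = complex.Re z * a.
Proof. by case: z => x y /=; rewrite mulr0 subr0. Qed.
Lemma ImMr (z : R[i]) (a : R) : complex.Im (z * a%:C) = complex.Im z * a.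
Proof. by case: z => x y /=; rewrite mulr0 add0r. Qed.

Lemma Re_sum I (s : seq I) (F : I -> R[i]) :
  complex.Re (\sum_(i <- s) F i) = \sum_(i <- s) complex.Re (F i).
Proof. by elim/big_rec2: _ => // i a b _ <-; rewrite ReD. Qed.
Lemma Im_sum I (s : seq I) (F : I -> R[i]) :
  complex.Im (\sum_(i <- s) F i) = \sum_(i <- s) complex.Im (F i).
Proof. by elim/big_rec2: _ => // i a b _ <-; rewrite ImD. Qed.

Lemma Re_mulmxr m n p (W : 'M[R[i]]_(m, n)) (B : 'M[R]_(n, p)) :
  reM (W *m toC B) = reM W *m B.
Proof.
apply/matrixP => i j; rewrite !mxE Re_sum; apply: eq_bigr => k _.
by rewrite !mxE ReMr.
Qed.
Lemma Im_mulmxr m n p (W : 'M[R[i]]_(m, n)) (B : 'M[R]_(n, p)) :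
  imM (W *m toC B) = imM W *m B.
Proof.
apply/matrixP => i j; rewrite !mxE Im_sum; apply: eq_bigr => k _.
by rewrite !mxE ImMr.
Qed.
Lemma Re_mulmxl m n p (A : 'M[R]_(m, n)) (W : 'M[R[i]]_(n, p)) :
  reM (toC A *m W) = A *m reM W.
Proof.
apply/matrixP => i j; rewrite !mxE Re_sum; apply: eq_bigr => k _.
by rewrite !mxE mulrC ReMr mulrC.
Qed.
Lemma Im_mulmxl m n p (A : 'M[R]_(m, n)) (W : 'M[R[i]]_(n, p)) :
  imM (toC A *m W) = A *m imM W.
Proof.
apply/matrixP => i j; rewrite !mxE Im_sum; apply: eq_bigr => k _.
by rewrite !mxE mulrC ImMr mulrC.
Qed.
End RealImaginary.

Section RealSpectral.
Variable R : rcfType.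

(** [p] and [q] are the real and imaginary parts of a left eigenvector for a + ib; comparing p T q^T
    with its transpose q T p^T gives b (|p|^2 + |q|^2) = 0. *)
Lemma sym_invariant_plane n (T : 'M[R]_n) (p q : 'rV[R]_n) (a b : R) :
  T^T = T -> p *m T = a *: p - b *: q -> q *m T = a *: q + b *: p ->
  (p != 0) || (q != 0) -> b = 0.
Proof.
move=> Ts pT qT pq0.
have e : (p *m T *m q^T) 0 0 = (q *m T *m p^T) 0 0.
  have -> : p *m T *m q^T = (q *m T *m p^T)^T by rewrite !trmx_mul trmxK Ts mulmxA.
  by rewrite mxE.
have pqC : (q *m p^T) 0 0 = (p *m q^T) 0 0.
  have -> : q *m p^T = (p *m q^T)^T by rewrite trmx_mul trmxK.
  by rewrite mxE.
move: e; rewrite pT qT mulmxBl mulmxDl -!scalemxAl.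
have addE (X Y : 'M[R]_1) : (X + Y) 0 0 = X 0 0 + Y 0 0 by rewrite mxE.
have oppE (X : 'M[R]_1) : (- X) 0 0 = - X 0 0 by rewrite mxE.
have scaleE a' (X : 'M[R]_1) : (a' *: X) 0 0 = a' * X 0 0 by rewrite mxE.
rewrite !addE oppE !scaleE pqC.
have := nsq_ge0 p^T; have := nsq_ge0 q^T; rewrite {1 2}/nsq /dotv !trmxK => qq pp.
move=> e; have /eqP : b * ((p *m p^T) 0 0 + (q *m q^T) 0 0) = 0 by lra.
rewrite mulf_eq0 => /orP[/eqP //|]; rewrite paddr_eq0 // => /andP[/eqP h1 /eqP h2].
move: pq0.
have -> : p = 0 by apply: (can_inj trmxK); rewrite trmx0; apply: nsq_eq0; rewrite /nsq /dotv trmxK.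
have -> : q = 0 by apply: (can_inj trmxK); rewrite trmx0; apply: nsq_eq0; rewrite /nsq /dotv trmxK.
by rewrite eqxx.
Qed.

(** Over C, the action [D] of T on the row space of [B] has an eigenvector. Its eigenvalue is real
    by symmetry, so its real or imaginary part, whichever is nonzero, gives a real one. *)
Lemma sym_eigenvector n r (T : 'M[R]_n) (B : 'M[R]_(r, n)) :
  (0 < r)%N -> T^T = T -> row_free B -> (B *m T <= B)%MS ->
  exists (v : 'rV[R]_n) (l : R), [/\ v != 0, (v <= B)%MS & v *m T = l *: v].
Proof.
move=> r0 Ts Bf /submxP[D BT].
have [a] := eigenvalue_closed (map_mx (real_complex R) D) r0.
case/eigenvalueP => w wD w0.
pose p := map_mx (@complex.Re R) w *m B; pose q := map_mx (@complex.Im R) w *m B.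
have pT : p *m T = complex.Re a *: p - complex.Im a *: q.
  rewrite -mulmxA BT mulmxA -Re_mulmxr wD !scalemxAl -mulmxBl; congr (_ *m _).
  by apply/rowP => i; rewrite !mxE; case: (w 0 i) => u v; case: (a).
have qT : q *m T = complex.Re a *: q + complex.Im a *: p.
  rewrite -mulmxA BT mulmxA -Im_mulmxr wD !scalemxAl -mulmxDl; congr (_ *m _).
  by apply/rowP => i; rewrite !mxE; case: (w 0 i) => u v; case: (a).
have pq0 : (p != 0) || (q != 0).
  rewrite -negb_and !mulmx_free_eq0 //; apply: contra w0 => /andP[/eqP h1 /eqP h2].
  apply/eqP/rowP => i; move/rowP/(_ i): h1; move/rowP/(_ i): h2; rewrite !mxE.
  by case: (w 0 i) => u v /= -> ->.
have a0 := sym_invariant_plane Ts pT qT pq0.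
case/orP: pq0 => ?; [exists p|exists q]; exists (complex.Re a); split => //;
  by rewrite ?submxMl // ?pT ?qT a0 scale0r ?subr0 ?addr0.
Qed.

Lemma orthonormal_eigenrows n (T : 'M[R]_n) k : T^T = T -> (k <= n)%N ->
  exists (W : 'M[R]_(k, n)) (D : 'rV[R]_k),
    W *m W^T = 1%:M /\ W *m T = diag_mx D *m W.
Proof.
move=> Ts; elim: k => [|k IH] kn.
  by exists 0, 0; split; apply/matrixP => -[].
have [W [D [WW WT]]] := IH (ltnW kn).
(* The orthogonal complement of the rows of [W] is invariant under T, and nonzero because k < n. *)
have [v [l [v0 vW vT]]] : exists (v : 'rV[R]_n) (l : R),
    [/\ v != 0, (v <= kermx W^T)%MS & v *m T = l *: v].
  have [] := @sym_eigenvector n _ T (row_base (kermx W^T)).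
  - by rewrite mxrank_ker subn_gt0 (leq_ltn_trans _ kn) // rank_leq_col.
  - exact: Ts.
  - exact: row_base_free.
  - rewrite (eqmxMr _ (eq_row_base _)) eq_row_base sub_kermx -mulmxA.
    have -> : T *m W^T = W^T *m diag_mx D.
      by rewrite -{1}Ts -trmx_mul WT trmx_mul tr_diag_mx.
    by rewrite mulmxA mulmx_ker mul0mx.
  by move=> v [l []]; rewrite eq_row_base => *; exists v, l.
have vp : 0 < (v *m v^T) 0 0.
  have := nsq_ge0 v^T; rewrite /nsq /dotv trmxK lt_def => ->; rewrite andbT.
  apply: contra v0 => /eqP h; apply/eqP/(can_inj trmxK); rewrite trmx0.
  by apply: nsq_eq0; rewrite /nsq /dotv trmxK.
pose c := (Num.sqrt ((v *m v^T) 0 0))^-1.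
have cvv : (c *: v) *m (c *: v)^T = 1%:M.
  rewrite linearZ -scalemxAl -scalemxAr [v *m v^T]mx11_scalar !scale_scalar_mx.
  by rewrite mulrA -expr2 exprVn sqr_sqrtr ?ltW // mulVf ?gt_eqF.
have cvW : (c *: v) *m W^T = 0.
  by apply/eqP; rewrite -sub_kermx; apply: submx_trans (scalemx_sub _ _) vW.
rewrite -addn1.
exists (col_mx W (c *: v)), (row_mx D l%:M); split.
  rewrite tr_col_mx mul_col_row WW cvv cvW.
  have -> : W *m (c *: v)^T = 0 by rewrite -[W]trmxK -trmx_mul cvW trmx0.
  by rewrite -scalar_mx_block.
rewrite mul_col_mx WT diag_mx_row mul_block_col !mul0mx addr0 add0r; congr col_mx.
rewrite -scalemxAl vT scalerA mulrC -scalerA; apply/rowP => i; rewrite !mxE.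
by rewrite big_ord1 !mxE eqxx !mulr1n.
Qed.

Lemma real_spectral n (T : 'M[R]_n) : T^T = T ->
  exists (P : 'M[R]_n) (D : 'rV[R]_n),
    P^T *m P = 1%:M /\ P *m T = diag_mx D *m P.
Proof.
move=> Ts; have [P [D [PP PT]]] := orthonormal_eigenrows Ts (leqnn n).
by exists P, D; split=> //; apply: mulmx1C.
Qed.

Lemma row_eigen n (T P : 'M[R]_n) (D : 'rV[R]_n) i :
  P *m T = diag_mx D *m P -> row i P *m T = D 0 i *: row i P.
Proof.
by move=> PT; rewrite -row_mul PT row_mul row_diag_mx -scalemxAl -rowE.
Qed.

(** Evaluate the quadratic form at the i-th row of [P], a unit eigenvector. *)
Lemma psd_eigenvalue_ge0 n (T P : 'M[R]_n) (D : 'rV[R]_n) i :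
  (forall x : 'cV[R]_n, 0 <= (x^T *m T *m x) 0 0) ->
  P^T *m P = 1%:M -> P *m T = diag_mx D *m P -> 0 <= D 0 i.
Proof.
move=> Tp /mulmx1C PP /(@row_eigen _ _ _ _ i) PT.
have := Tp (row i P)^T; rewrite trmxK PT -scalemxAl mxE.
have -> : (row i P *m (row i P)^T) 0 0 = (P *m P^T) i i.
  by rewrite !mxE; apply: eq_bigr => k _; rewrite !mxE.
by rewrite PP mxE eqxx mulr1.
Qed.

Lemma conj_diag_pow n (P : 'M[R]_n) (D : 'rV[R]_n) k : P^T *m P = 1%:M ->
  (P^T *m diag_mx D *m P) ^+ k = P^T *m diag_mx (map_mx (fun a => a ^+ k) D) *m P.
Proof.
move=> PP; elim: k => [|k IH].
  have -> : map_mx (fun a => a ^+ 0) D = const_mx 1 by apply/rowP => i; rewrite !mxE expr0.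
  by rewrite diag_const_mx mulmx1 PP expr0.
have -> : diag_mx (map_mx (fun a => a ^+ k.+1) D) =
    diag_mx D *m diag_mx (map_mx (fun a => a ^+ k) D).
  by apply/matrixP => i j; rewrite mul_diag_mx !mxE exprS mulrnAr.
rewrite exprS IH -[LHS]/(_ *m _) -!mulmxA [P *m (P^T *m _)]mulmxA.
by rewrite (mulmx1C PP) mul1mx !mulmxA.
Qed.

End RealSpectral.

(** Diagonalise orthogonally and take k-th roots of the nonnegative eigenvalues. *)
Lemma psd_root_exists (R : realType) n (M : 'M[R]_n) k : (0 < k)%N ->
  psdmx M -> exists S, psdmx S /\ S ^+ k = M.
Proof.
move=> k0 [Ms Mp]; have [P [D [PP PM]]] := real_spectral Ms.
pose E := map_mx (fun a => a `^ (k%:R^-1)) D.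
have ED : map_mx (fun a => a ^+ k) E = D.
  apply/rowP => i; rewrite !mxE -powR_mulrn ?powR_ge0 // -powRrM mulVf ?pnatr_eq0 -?lt0n //.
  by rewrite powRr1 // (psd_eigenvalue_ge0 i Mp PP PM).
exists (P^T *m diag_mx E *m P); split; last first.
  by rewrite conj_diag_pow // ED -mulmxA -PM mulmxA PP mul1mx.
split=> [|x]; first by rewrite !trmx_mul tr_diag_mx trmxK mulmxA.
have -> : x^T *m (P^T *m diag_mx E *m P) *m x = (P *m x)^T *m (diag_mx E *m (P *m x)).
  by rewrite trmx_mul !mulmxA.
rewrite -/(dotv _ _) dotvE sumr_ge0 // => i _.
by rewrite mul_diag_mx !mxE mulrCA mulr_ge0 ?powR_ge0 // -expr2 sqr_ge0.
Qed.

Lemma psd_root_spec (R : realType) n (M : 'M[R]_n) k : (0 < k)%N ->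
  psdmx M -> psdmx (psd_root k M) /\ psd_root k M ^+ k = M.
Proof. by move=> k0 Mp; exact: (getPex (psd_root_exists k0 Mp)). Qed.

Lemma psdmx_gram (R : realType) n (B : 'M[R]_n) : psdmx (B^T *m B).
Proof.
split=> [|x]; first by rewrite trmx_mul trmxK.
by rewrite mulmxA -mulmxA -trmx_mul; exact: nsq_ge0.
Qed.

(** * Eigenspaces and growth *)

(** If c > 0, then (r/s)^n would stay bounded, against Bernoulli's inequality. *)
Lemma geom_domination_eq0 (R : realType) (c C s r : R) : 0 <= c -> 0 < s -> s < r ->
  (forall n, c * r ^+ n <= C * s ^+ n) -> c = 0.
Proof.
move=> c0 s0 sr h; apply/eqP; rewrite eq_le c0 andbT leNgt; apply/negP => cp.
pose e := r / s - 1.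
have e0 : 0 < e by rewrite subr_gt0 ltr_pdivlMr ?mul1r.
have bern n : 1 + n%:R * e <= (r / s) ^+ n.
  have re : r / s = 1 + e by rewrite /e addrC subrK.
  elim: n => [|n IH]; first by rewrite mul0r addr0 expr0.
  rewrite exprS {1}re; apply: (@le_trans _ _ ((1 + e) * (1 + n%:R * e))).
    have : 0 <= n%:R * e * e by rewrite !mulr_ge0 ?ler0n ?ltW.
    rewrite -natr1; lra.
  by rewrite ler_pM2l // addr_gt0.
have [n nC] : exists n : nat, C / (c * e) < n%:R.
  exists (Num.bound `|C / (c * e)|).
  by apply: le_lt_trans (ler_norm _) _; rewrite archi_boundP.
have := h n; rewrite -ler_pdivrMr ?exprn_gt0 // -mulrA -expr_div_n.
move=> hn; have : c * (1 + n%:R * e) <= C.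
  by apply: le_trans hn; rewrite ler_pM2l.
move: nC; rewrite ltr_pdivrMr ?mulr_gt0 //; lra.
Qed.

Section ComplexGrowth.
Variables (R : rcfType) (d : nat).
Implicit Types (A : 'M[R[i]]_d) (w : 'cV[R[i]]_d) (y : 'rV[R[i]]_d).

Lemma normc_ge0 (z : R[i]) : 0 <= normc z.
Proof. by case: z => a b; exact: sqrtr_ge0. Qed.

(** Induction on k, using A^(n+1) w = l A^n w + A^n (A - l) w; the slack between |l| and r absorbs
    the polynomial factor of a Jordan block. *)
Lemma gen_eigenvector_growth A l w k (r : R) : normc l < r ->
  (A - l%:M) ^+ k *m w = 0 ->
  exists2 C : R, 0 <= C & forall n i, normc ((A ^+ n *m w) i 0) <= C * r ^+ n.
Proof.
move=> lr; have r0 : 0 < r by apply: le_lt_trans lr; exact: normc_ge0.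
elim: k w => [|k IH] w.
  rewrite expr0 mul1mx => ->; exists 0 => // n i.
  by rewrite mulmx0 mxE normc0 mul0r.
rewrite exprSr -mulmxA => /IH [C C0 hC].
pose c := \sum_i normc (w i 0).
(* [K] dominates the entries of [w] and satisfies |l| K + C <= r K, which closes the induction on
   n. *)
pose K := c + C / (r - normc l).
have c0 : 0 <= c by apply: sumr_ge0 => i _; exact: normc_ge0.
have rl : 0 < r - normc l by rewrite subr_gt0.
have K0 : 0 <= K by rewrite addr_ge0 // divr_ge0 // ltW.
exists K => // n i; elim: n => [|n IHn].
  rewrite expr0 mul1mx mulr1; apply: (@le_trans _ _ c).
    by rewrite /c (bigD1 i) //= lerDl sumr_ge0 // => j _; exact: normc_ge0.
  by rewrite lerDl divr_ge0 // ltW.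
have -> : (A ^+ n.+1 *m w) i 0 =
    l * (A ^+ n *m w) i 0 + (A ^+ n *m ((A - l%:M) *m w)) i 0.
  have -> : A ^+ n.+1 *m w = A ^+ n *m (A *m w) by rewrite exprSr mulmxA.
  have -> : A *m w = l *: w + (A - l%:M) *m w.
    by rewrite mulmxBl mul_scalar_mx addrC subrK.
  by rewrite mulmxDr -scalemxAr !mxE.
apply: le_trans (le_normcD _ _) _; rewrite normcM.
apply: (@le_trans _ _ (normc l * (K * r ^+ n) + C * r ^+ n)).
  by rewrite lerD // ler_wpM2l ?normc_ge0.
have KC : K * (r - normc l) = c * (r - normc l) + C.
  by rewrite mulrDl divfK ?gt_eqF.
rewrite exprS -subr_ge0.
have -> : K * (r * r ^+ n) - (normc l * (K * r ^+ n) + C * r ^+ n) =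
    r ^+ n * (K * (r - normc l) - C) by ring.
by rewrite KC addrK mulr_ge0 ?exprn_ge0 ?(ltW r0) // mulr_ge0 // ltW.
Qed.

End ComplexGrowth.

Section RowGrowth.
Variables (R : rcfType) (d : nat) (A : 'M[R]_d.+1).
Local Notation toC := (map_mx (real_complex R)).
Local Notation euc x := (Num.sqrt (nsq x)).

Lemma normc_row_mul_le (y : 'rV[R[i]]_d.+1) (x : 'cV[R]_d.+1) :
  normc ((y *m toC x) 0 0) <= (\sum_i normc (y 0 i)) * euc x.
Proof.
rewrite mxE mulr_suml; elim/big_ind2: _ => [|a b u v h1 h2|i _].
- by rewrite normc0.
- by apply: le_trans (le_normcD _ _) _; exact: lerD.
rewrite normcM ler_wpM2l ?normc_ge0 // mxE /= expr0n addr0 sqrtr_sqr.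
by rewrite -sqrtr_sqr ler_wsqrtr // sqr_entry_le_nsq.
Qed.

(** Dual of [gen_eigenvector_growth]: peel off one root l and use l y x = y A x - y' x, where the
    row y' = y (A - l) is covered by induction on s. The slack is now |l| > r. *)
Lemma row_lower_growth (s : seq R[i]) (r : R) (y : 'rV[R[i]]_d.+1) : 0 < r ->
  all (fun l => r < normc l) s ->
  y *m horner_mx (toC A) (\prod_(l <- s) ('X - l%:P)) = 0 ->
  exists2 C, 0 <= C & forall n x,
    normc ((y *m toC x) 0 0) * r ^+ n <= C * euc (A ^+ n *m x).
Proof.
move=> r0; elim: s y => [|l s IH] y.
  rewrite big_nil rmorph1 mulmx1 => _ ->; exists 0 => // n x.
  by rewrite mul0mx mxE normc0 !mul0r.
case/andP => lr /IH{}IH; rewrite big_cons rmorphM mulmxA.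
rewrite rmorphB /= horner_mx_X horner_mx_C => /IH [C C0 hC].
pose c := \sum_i normc (y 0 i).
have c0 : 0 <= c by apply: sumr_ge0 => i _; exact: normc_ge0.
have rl : 0 < normc l - r by rewrite subr_gt0.
(* Chosen so that r K + C <= |l| K. *)
pose K := c + C / (normc l - r).
have K0 : 0 <= K by rewrite addr_ge0 // divr_ge0 // ltW.
have KC : K * (normc l - r) = c * (normc l - r) + C.
  by rewrite mulrDl divfK ?gt_eqF.
exists K => // n; elim: n => [|n IHn] x.
  rewrite expr0 mulr1 mul1mx; apply: le_trans (normc_row_mul_le _ _) _.
  by rewrite ler_wpM2r ?sqrtr_ge0 // lerDl divr_ge0 // ltW.
have lp : 0 < normc l by apply: lt_trans lr.
rewrite -(ler_pM2l lp) mulrA -normcM.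
have -> : l * (y *m toC x) 0 0 =
    (y *m toC (A *m x)) 0 0 - (y *m (toC A - l%:M) *m toC x) 0 0.
  rewrite mulmxBr mulmxBl map_mxM mulmxA mul_mx_scalar -scalemxAl !mxE.
  by rewrite opprB addrC subrK.
apply: (@le_trans _ _ (normc ((y *m toC (A *m x)) 0 0) * r ^+ n.+1 +
    normc ((y *m (toC A - l%:M) *m toC x) 0 0) * r ^+ n.+1)).
  rewrite -mulrDl ler_wpM2r ?exprn_ge0 ?(ltW r0) //.
  by apply: le_trans (le_normcD _ _) _; rewrite normcN.
set E := euc _.
have h1 : normc ((y *m toC (A *m x)) 0 0) * r ^+ n.+1 <= r * (K * E).
  rewrite exprS mulrCA ler_pM2l //.
  have -> : E = euc (A ^+ n *m (A *m x)) by rewrite /E exprSr mulmxA.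
  exact: IHn.
have h2 := hC n.+1 x.
apply: le_trans (lerD h1 h2) _.
have -> : normc l * (K * E) = r * (K * E) + K * (normc l - r) * E by ring.
by rewrite KC lerD2l ler_wpM2r ?sqrtr_ge0 // lerDr mulr_ge0 // ltW.
Qed.

End RowGrowth.

(** For alpha > 0 these are the x with limsup |Z^k x|^(1/k) < alpha. *)
Definition growth_space (R : realType) d (alpha : R) (Z : 'M[R]_d) : set 'cV[R]_d :=
  [set x | exists r C : R, [/\ 0 < r, r < alpha &
    forall k, nsq (Z ^+ k *m x) <= C * (r ^+ k) ^+ 2]].

(* Such a y is orthogonal to the growth space; it is the transpose of a row
   on which Z, acting on the right, expands at least by any r < alpha. *)
Definition lower_growth (R : realType) d (alpha : R) (Z : 'M[R]_d) : set 'cV[R]_d :=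
  [set y | forall r, 0 < r -> r < alpha -> exists C : R,
    forall n x, dotv y x ^+ 2 * (r ^+ n) ^+ 2 <= C * nsq (Z ^+ n *m x)].

(** If x grows at rate s < alpha, take r strictly between s and alpha: <y, x>^2 r^(2n) = O(s^(2n))
    forces <y, x> = 0. *)
Lemma lower_growth_ortho (R : realType) d (alpha : R) (Z : 'M[R]_d) x y :
  growth_space alpha Z x -> lower_growth alpha Z y -> dotv y x = 0.
Proof.
move=> [s [C [s0 sa hs]]] /(_ ((s + alpha) / 2)).
set r := (s + alpha) / 2; have sr : s < r by rewrite /r; lra.
have ra : r < alpha by rewrite /r; lra.
have r0 : 0 < r by apply: lt_trans sr.
move=> /(_ r0 ra) [K hK].
apply/eqP; rewrite -sqrf_eq0; apply/eqP.
apply: (@geom_domination_eq0 _ _ (`|K| * C) (s ^+ 2) (r ^+ 2)).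
- exact: sqr_ge0.
- exact: exprn_gt0.
- by rewrite ltr_pXn2r ?nnegrE ?ltW.
move=> n; rewrite -!exprM ![(2 * n)%N]mulnC !exprM; apply: le_trans (hK n x) _.
rewrite -mulrA; apply: (@le_trans _ _ (`|K| * nsq (Z ^+ n *m x))).
  by rewrite ler_wpM2r ?nsq_ge0 // ler_norm.
by rewrite ler_wpM2l.
Qed.

Section RealSpan.
Variables (R : realType) (d : nat) (A : 'M[R]_d.+1) (alpha : R).
Local Notation toC := (map_mx (real_complex R)).
Local Notation euc x := (Num.sqrt (nsq x)).

Let W := [set w | exists l : R[i],
    `|l| < alpha%:C /\ gen_eigenvector A l w].

Lemma normc_ltE (l : R[i]) : (`|l| < alpha%:C) = (normc l < alpha).
Proof. by rewrite -ltcR normc_def; case: l. Qed.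

(** Primary decomposition, one root at a time: a Bezout relation between one factor and the product
    of the others splits w. *)
Lemma gen_eigenvector_decomposition (t : seq R[i]) (e : R[i] -> nat) w :
  uniq t -> all (fun l => normc l < alpha) t ->
  horner_mx (toC A) (\prod_(l <- t) ('X - l%:P) ^+ e l) *m w = 0 ->
  exists2 ws : seq 'cV[R[i]]_d.+1, (forall u, u \in ws -> W u) & w = \sum_(u <- ws) u.
Proof.
elim: t w => [|l t IH] w.
  by rewrite big_nil rmorph1 mul1mx => _ _ ->; exists [::]; rewrite ?big_nil.
move=> /andP[lt ut] /andP[la ta]; rewrite big_cons.
set p := _ ^+ _; set q := \prod_(_ <- _) _ => pqw.
have : coprimep p q.
  rewrite coprimep_expl // /q; elim: (t) lt => [|m t' IHt].
    by rewrite big_nil coprimep1.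
  rewrite inE negb_or => /andP[lm lt']; rewrite big_cons coprimepMr IHt // andbT.
  by rewrite coprimep_expr // coprimep_XsubC root_XsubC eq_sym.
case/Bezout_eq1_coprimepP => -[u v] /= uv.
have pqC : p * q = q * p by rewrite mulrC.
have wE : w = horner_mx (toC A) (u * p) *m w + horner_mx (toC A) (v * q) *m w.
  by rewrite -mulmxDl -rmorphD uv rmorph1 mul1mx.
have [|ws hws w1] := IH (horner_mx (toC A) (u * p) *m w) ut ta.
  rewrite mulmxA -[X in X *m w]/(_ * _) -rmorphM mulrCA -pqC rmorphM -mulmxA pqw.
  by rewrite mulmx0.
have w2 : (toC A - l%:M) ^+ e l *m (horner_mx (toC A) (v * q) *m w) = 0.
  have -> : (toC A - l%:M) ^+ e l = horner_mx (toC A) p.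
    by rewrite rmorphXn rmorphB /= horner_mx_X horner_mx_C.
  rewrite mulmxA -[X in X *m w]/(_ * _) -rmorphM mulrCA rmorphM -mulmxA pqw.
  by rewrite mulmx0.
rewrite wE w1; set z := horner_mx _ (v * q) *m w in w2 *.
(* A zero component has to be dropped, since generalized eigenvectors are nonzero. *)
have [->|z0] := eqVneq z 0; first by exists ws; rewrite // addr0.
exists (z :: ws); last by rewrite big_cons addrC.
move=> a; rewrite inE => /orP[/eqP->|]; last exact: hws.
by exists l; rewrite normc_ltE; split=> //; split=> //; exists (e l).
Qed.

Lemma real_span_sum (ws : seq 'cV[R[i]]_d.+1) (x : 'cV[R]_d.+1) :
  (forall u, u \in ws -> W u) -> toC x = \sum_(u <- ws) u ->
  alpha_eigenspace alpha A x.
Proof.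
move=> hws xw; exists (size ws), (fun j => ws`_j), (fun=> 1), (fun=> 0); split.
  by move=> j; apply: hws; rewrite mem_nth.
apply/colP => i; have := congr1 (fun M : 'cV_d.+1 => complex.Re (M i 0)) xw.
rewrite mxE /= => ->; rewrite (big_nth 0) big_mkord !summxE Re_sum.
by apply: eq_bigr => j _; rewrite scale1r scale0r addr0 mxE.
Qed.

(** Write the characteristic polynomial as p q, the roots of p being those of modulus below alpha.
    Rows of p(A) are killed by q(A), so their real and imaginary parts lie in [lower_growth] and
    annihilate x; hence p(A) x = 0 and x splits into generalized eigenvectors. *)
Lemma lower_growth_separates (x : 'cV[R]_d.+1) : 0 < alpha ->
  (forall y, lower_growth alpha A y -> dotv y x = 0) ->
  alpha_eigenspace alpha A x.
Proof.
move=> a0 hx.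
have [s cA] := closed_field_poly_normal (char_poly (toC A)).
rewrite (monicP (char_poly_monic _)) scale1r in cA.
pose P (l : R[i]) := normc l < alpha.
pose p := \prod_(l <- s | P l) ('X - l%:P).
pose q := \prod_(l <- s | ~~ P l) ('X - l%:P).
have pq0 : horner_mx (toC A) p *m horner_mx (toC A) q = 0.
  rewrite -[LHS]/(_ * _) -rmorphM -(Cayley_Hamilton (toC A)); congr horner_mx.
  by rewrite cA [RHS](bigID P).
have px : horner_mx (toC A) p *m toC x = 0.
  apply/colP => i; rewrite [RHS]mxE.
  have [y0 yP] : exists y, y = row i (horner_mx (toC A) p) by eexists.
  have low r : 0 < r -> r < alpha -> exists2 C : R, 0 <= C & forall n u,
      normc ((y0 *m toC u) 0 0) * r ^+ n <= C * euc (A ^+ n *m u).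
    move=> r0 ra; apply: (row_lower_growth (s := [seq l <- s | ~~ P l]) r0).
      apply/allP => l; rewrite mem_filter -leNgt => /andP[h _].
      exact: lt_le_trans h.
    by rewrite big_filter yP -row_mul pq0 row0.
  (* [f] stands for the real or the imaginary part. *)
  have low' (f : R[i] -> R) y : (forall z, f z ^+ 2 <= normc z ^+ 2) ->
      (forall u, dotv y u = f ((y0 *m toC u) 0 0)) -> lower_growth alpha A y.
    move=> fn yf r r0 ra; have [C C0 hC] := low r r0 ra.
    exists (C ^+ 2) => n u; rewrite yf.
    have -> : nsq (A ^+ n *m u) = euc (A ^+ n *m u) ^+ 2.
      by rewrite sqr_sqrtr ?nsq_ge0.
    rewrite -[C ^+ 2 * _]exprMn; apply: (@le_trans _ _ (normc ((y0 *m toC u) 0 0) ^+ 2 * (r ^+ n) ^+ 2)).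
      by rewrite ler_wpM2r ?sqr_ge0.
    have h1 : 0 <= normc ((y0 *m toC u) 0 0) * r ^+ n.
      by rewrite mulr_ge0 ?normc_ge0 ?exprn_ge0 ?(ltW r0).
    by rewrite -exprMn ler_pXn2r ?nnegrE // (le_trans h1).
  have yE : (horner_mx (toC A) p *m toC x) i 0 = (y0 *m toC x) 0 0.
    by rewrite yP -row_mul [RHS]mxE.
  rewrite yE; apply/eqP; rewrite eq_complex /=.
  have re u : dotv (map_mx (@complex.Re R) y0)^T u = complex.Re ((y0 *m toC u) 0 0).
    by rewrite /dotv trmxK -Re_mulmxr mxE.
  have im u : dotv (map_mx (@complex.Im R) y0)^T u = complex.Im ((y0 *m toC u) 0 0).
    by rewrite /dotv trmxK -Im_mulmxr mxE.
  have sq z : normc z ^+ 2 = complex.Re z ^+ 2 + complex.Im z ^+ 2.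
    by case: z => a b /=; rewrite sqr_sqrtr // addr_ge0 ?sqr_ge0.
  rewrite -re -im !hx ?eqxx //.
    by apply: low' im => z; rewrite sq lerDr sqr_ge0.
  by apply: low' re => z; rewrite sq lerDl sqr_ge0.
(* Repeated roots are collected into powers, as the decomposition takes distinct roots. *)
move: px; rewrite /p -big_filter -prodr_undup_exp_count => /gen_eigenvector_decomposition.
case; first exact: undup_uniq.
  by apply/allP => l; rewrite mem_undup mem_filter => /andP[].
by move=> ws hws xw; apply: real_span_sum hws xw.
Qed.

Lemma growth_subset_eigenspace : 0 < alpha ->
  growth_space alpha A `<=` alpha_eigenspace alpha A.
Proof.
move=> a0 x gx; apply: lower_growth_separates => // y.
exact: lower_growth_ortho.
Qed.
End RealSpan.

Section GrowthSubspace.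
Variables (R : realType) (d : nat) (A : 'M[R]_d) (alpha : R).
Local Notation toC := (map_mx (real_complex R)).

Lemma growth_space0 : 0 < alpha -> growth_space alpha A 0.
Proof.
move=> a0; exists (alpha / 2), 0; split; [lra|lra|move=> k].
by rewrite mulmx0 mul0r /nsq /dotv mulmx0 mxE.
Qed.

Lemma growth_spaceZ a x : growth_space alpha A x -> growth_space alpha A (a *: x).
Proof.
move=> [r [C [r0 ra h]]]; exists r, (a ^+ 2 * C); split=> // k.
by rewrite -scalemxAr nsqZ -mulrA ler_wpM2l ?sqr_ge0.
Qed.

Lemma growth_spaceD x y : growth_space alpha A x -> growth_space alpha A y ->
  growth_space alpha A (x + y).
Proof.
move=> [r [C [r0 ra hr]]] [s [D [s0 sa hs]]].
pose t := Num.max r s.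
have C0 : 0 <= C by have := hr 0%N; rewrite !expr0 expr1n mulr1; apply: le_trans (nsq_ge0 _).
have D0 : 0 <= D by have := hs 0%N; rewrite !expr0 expr1n mulr1; apply: le_trans (nsq_ge0 _).
exists t, (2 * C + 2 * D); split; first by rewrite lt_max r0.
  by rewrite gt_max ra.
move=> k; rewrite mulmxDr; apply: le_trans (nsqD_le _ _) _.
have h1 : nsq (A ^+ k *m x) <= C * (t ^+ k) ^+ 2.
  by apply: le_trans (hr k) _; rewrite ler_wpM2l // ler_exprn_sqr ?(ltW r0) // le_max lexx.
have h2 : nsq (A ^+ k *m y) <= D * (t ^+ k) ^+ 2.
  by apply: le_trans (hs k) _; rewrite ler_wpM2l // ler_exprn_sqr ?(ltW s0) // le_max lexx orbT.
lra.
Qed.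

(** Meant for [Re] and [Im], which commute with the real matrix A; the factor d comes from summing
    over the entries. *)
Lemma growth_space_proj (f : R[i] -> R) (w : 'cV[R[i]]_d) (r C : R) :
  (forall z, `|f z| <= normc z) ->
  (forall k, A ^+ k *m map_mx f w = map_mx f (toC A ^+ k *m w)) ->
  0 < r -> r < alpha ->
  (forall n i, normc ((toC A ^+ n *m w) i 0) <= C * r ^+ n) ->
  growth_space alpha A (map_mx f w).
Proof.
move=> fn fA r0 ra hC; exists r, (d%:R * C ^+ 2); split=> // k.
rewrite fA nsqE -mulrA -exprMn -[d in d%:R]card_ord mulr_natl -sumr_const.
apply: ler_sum => i _; rewrite mxE -[leLHS]real_normK ?num_real //.
have h := le_trans (fn _) (hC k i).
by rewrite ler_pXn2r ?nnegrE // (le_trans _ h).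
Qed.

Lemma toC_pow k : toC (A ^+ k) = toC A ^+ k.
Proof. by elim: k => [|k IH]; rewrite ?expr0 ?map_mx1 // !exprS map_mxM IH. Qed.

(** Growth spaces are subspaces, so the two parts of a single generalized eigenvector suffice; the
    rate lies midway between |l| and alpha. *)
Lemma eigenspace_subset_growth : 0 < alpha ->
  alpha_eigenspace alpha A `<=` growth_space alpha A.
Proof.
move=> a0 x [m [w [a [b [hw ->]]]]].
elim/big_ind: _ => [|u v|j _]; [exact: growth_space0|exact: growth_spaceD|].
have [l [la [_ [k wk]]]] := hw j; rewrite normc_ltE in la.
pose r := (normc l + alpha) / 2.
have lr : normc l < r by rewrite /r; lra.
have ra : r < alpha by rewrite /r; lra.
have r0 : 0 < r by apply: le_lt_trans lr; exact: normc_ge0.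
have [C C0 hC] := gen_eigenvector_growth lr wk.
apply: growth_spaceD; apply: growth_spaceZ; apply: growth_space_proj r0 ra hC.
- by case=> u v; rewrite /= -sqrtr_sqr ler_wsqrtr // lerDl sqr_ge0.
- by move=> n; rewrite -toC_pow Re_mulmxl.
- by case=> u v; rewrite /= -sqrtr_sqr ler_wsqrtr // lerDr sqr_ge0.
- by move=> n; rewrite -toC_pow Im_mulmxl.
Qed.
End GrowthSubspace.

Lemma alpha_eigenspace_growth (R : realType) d (A : 'M[R]_d.+1) (alpha : R) :
  0 < alpha -> alpha_eigenspace alpha A = growth_space alpha A.
Proof.
move=> a0; apply/seteqP; split.
  exact: eigenspace_subset_growth.
exact: growth_subset_eigenspace.
Qed.

(** * Limit points of the roots *)

Section PsdFromGrowth.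
Variables (R : realType) (d : nat).

Lemma pow_eigenvector (T : 'M[R]_d) (x : 'cV[R]_d) t k :
  T *m x = t *: x -> T ^+ k *m x = t ^+ k *: x.
Proof.
move=> Tx; elim: k => [|k IH]; first by rewrite !expr0 mul1mx scale1r.
have -> : T ^+ k.+1 *m x = T ^+ k *m (T *m x) by rewrite exprSr mulmxA.
by rewrite Tx -scalemxAr IH scalerA exprS.
Qed.

Lemma eigenvector_growth (T : 'M[R]_d) (x : 'cV[R]_d) t alpha :
  0 <= t -> t < alpha -> T *m x = t *: x -> growth_space alpha T x.
Proof.
(* The rate is not t itself, which may be 0, but a positive number above it. *)
move=> t0 ta Tx; exists ((t + alpha) / 2), (nsq x); split; [lra|lra|move=> k].
rewrite (pow_eigenvector k Tx) nsqZ mulrC ler_wpM2l ?nsq_ge0 //.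
by apply: ler_exprn_sqr => //; lra.
Qed.

(** Cauchy-Schwarz applied to <y, T^n x> = s^n <y, x>. *)
Lemma eigenvector_lower_growth (T : 'M[R]_d) (y : 'cV[R]_d) s :
  T^T = T -> T *m y = s *: y -> lower_growth s T y.
Proof.
move=> Ts Ty r r0 rs; exists (nsq y) => n x.
apply: le_trans (cauchy_schwarz _ _).
have -> : dotv y (T ^+ n *m x) = s ^+ n * dotv y x.
  by rewrite dotvC dotv_mulmx trmxX Ts (pow_eigenvector n Ty) dotvC dotvZl.
rewrite exprMn mulrC ler_wpM2r ?sqr_ge0 //.
by apply: ler_exprn_sqr; lra.
Qed.

Lemma eigenvectors_ortho (T U : 'M[R]_d) (x y : 'cV[R]_d) t s :
  (forall alpha, 0 < alpha -> growth_space alpha T `<=` growth_space alpha U) ->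
  U^T = U -> 0 <= t -> t < s -> T *m x = t *: x -> U *m y = s *: y -> dotv y x = 0.
Proof.
move=> TU Us t0 ts Tx Uy.
apply: (@lower_growth_ortho _ _ s U); last exact: eigenvector_lower_growth.
by apply: TU; [exact: le_lt_trans ts|exact: eigenvector_growth Tx].
Qed.

(** Entry (i, j) of P Q^T is the product of the i-th eigenvector of T and the j-th of U; it vanishes
    unless their eigenvalues agree. So P Q^T intertwines the two diagonal forms, whence T = U. *)
Lemma psd_eq_growth (T U : 'M[R]_d) : psdmx T -> psdmx U ->
  (forall alpha, 0 < alpha -> growth_space alpha T = growth_space alpha U) -> T = U.
Proof.
move=> [Ts Tp] [Us Up] TU.
have [P [D [PP PT]]] := real_spectral Ts.
have [Q [E [QQ QU]]] := real_spectral Us.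
have D0 i := psd_eigenvalue_ge0 i Tp PP PT.
have E0 i := psd_eigenvalue_ge0 i Up QQ QU.
have eigen (V W : 'M[R]_d) F i : V^T = V -> W *m V = diag_mx F *m W ->
    V *m (row i W)^T = F 0 i *: (row i W)^T.
  by move=> Vs WV; rewrite -{1}Vs -trmx_mul (row_eigen i WV) linearZ.
have PQ : diag_mx D *m (P *m Q^T) = P *m Q^T *m diag_mx E.
  apply/matrixP => i j; rewrite mul_diag_mx mul_mx_diag !mxE.
  have -> : \sum_k P i k * Q^T k j = dotv (row j Q)^T (row i P)^T.
    by rewrite dotvE; apply: eq_bigr => k _; rewrite !mxE mulrC.
  have eP := eigen T P D i Ts PT; have eQ := eigen U Q E j Us QU.
  case: (ltgtP (D 0 i) (E 0 j)) => [lt|lt|->]; last by rewrite mulrC.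
    rewrite (eigenvectors_ortho _ Us (D0 i) lt eP eQ) ?mulr0 ?mul0r //.
    by move=> a a0; rewrite TU.
  rewrite dotvC (eigenvectors_ortho _ Ts (E0 j) lt eQ eP) ?mulr0 ?mul0r //.
  by move=> a a0; rewrite TU.
rewrite -[T]mul1mx -PP -mulmxA PT -[P in diag_mx D *m P]mulmx1 -QQ.
rewrite [P *m (_ *m _)]mulmxA [diag_mx D *m _]mulmxA PQ -!mulmxA -QU.
by rewrite [P^T *m _]mulmxA PP mul1mx mulmxA QQ mul1mx.
Qed.

End PsdFromGrowth.

(** * Limits of matrices along filters *)

Section EntrywiseLimits.
Variables (R : realType) (I : Type) (F : set_system I).
Context {FF : ProperFilter F}.

(** Entrywise, so that scalar limit theorems apply, and along any proper filter, so that
    ultrafilters are covered. *)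
Definition entry_cvg m n (S : I -> 'M[R]_(m, n)) (T : 'M[R]_(m, n)) :=
  forall i j, (fun t => S t i j) @ F --> T i j.

Lemma entry_cvg_cst m n (T : 'M[R]_(m, n)) : entry_cvg (fun=> T) T.
Proof. by move=> i j; exact: cvg_cst. Qed.

Lemma entry_cvg_mulmx m n p (S : I -> 'M[R]_(m, n)) T (S' : I -> 'M[R]_(n, p)) T' :
  entry_cvg S T -> entry_cvg S' T' -> entry_cvg (fun t => S t *m S' t) (T *m T').
Proof.
move=> h h' i j; rewrite mxE.
under eq_fun do rewrite mxE.
by apply: cvg_big => [|k _]; [exact: add_continuous|exact: cvgM].
Qed.

Lemma entry_cvg_trmx m n (S : I -> 'M[R]_(m, n)) T :
  entry_cvg S T -> entry_cvg (fun t => (S t)^T) T^T.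
Proof. by move=> h i j; rewrite mxE; under eq_fun do rewrite mxE; exact: h. Qed.

Lemma entry_cvg_pow d (S : I -> 'M[R]_d) T k :
  entry_cvg S T -> entry_cvg (fun t => S t ^+ k) (T ^+ k).
Proof.
move=> h; elim: k => [|k IH]; first by rewrite expr0; exact: entry_cvg_cst.
by rewrite exprS; under [X in entry_cvg X]eq_fun do rewrite exprS; exact: entry_cvg_mulmx.
Qed.

Lemma nsq_pow_cvg d (S : I -> 'M[R]_d) T k (x : 'cV[R]_d) :
  entry_cvg S T -> (fun t => nsq (S t ^+ k *m x)) @ F --> nsq (T ^+ k *m x).
Proof.
move=> h.
have hx : entry_cvg (fun t => S t ^+ k *m x) (T ^+ k *m x).
  by apply: entry_cvg_mulmx; [exact: entry_cvg_pow|exact: entry_cvg_cst].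
by have := entry_cvg_mulmx (entry_cvg_trmx hx) hx; exact.
Qed.

Lemma psdmx_entry_cvg d (S : I -> 'M[R]_d) T :
  entry_cvg S T -> (\forall t \near F, psdmx (S t)) -> psdmx T.
Proof.
move=> h Sp; split=> [|x].
  apply/matrixP => i j; rewrite mxE.
  apply: (@cvg_unique _ (@norm_hausdorff _ R) _ _ _ _ (h j i) _).
  apply: cvg_trans (h i j); apply: near_eq_cvg; apply: filterS Sp => t [St _].
  by rewrite -{1}St mxE.
have hx : entry_cvg (fun t => x^T *m S t *m x) (x^T *m T *m x).
  by do ![apply: entry_cvg_mulmx|exact: entry_cvg_cst].
apply: (cvgr_to_ge (hx 0 0)); apply: filterS Sp => t [_]; exact.
Qed.

End EntrywiseLimits.

Lemma cvg_mx_entries (R : realType) (F : set_system nat) (FF : ProperFilter F) m n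
  (S : nat -> 'M[R]_(m, n)) T : entry_cvg F S T -> S @ F --> T.
Proof.
move=> h A [P TP PA].
have : \forall t \near F, forall i j, P i j (S t i j).
  apply: filter_forall => i; apply: filter_forall => j.
  exact: h (TP i j).
by apply: filterS => t Pt; apply: PA.
Qed.

(** Compactness of [-M, M] gives a cluster point, which for an ultrafilter is a limit. *)
Lemma ultra_bounded_cvg (R : realType) I (G : set_system I) (f : I -> R) M :
  UltraFilter G -> (\forall t \near G, `|f t| <= M) -> exists l : R, f @ G --> l.
Proof.
move=> GU fM.
have [|l [_ cl]] := @segment_compact R (- M) M (fmap f G) _.
  by apply: filterS fM => t; rewrite /= in_itv /= ler_norml.
exists l => V lV; have [//|nV] := in_ultra_setVsetC (f @^-1` V) GU.
have [] := cl (~` V) V nV lV; by move=> z [].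
Qed.

(** * Convergence of the roots *)

Section Limit.
Variables (R : realType) (d : nat) (A : 'M[R]_d.+1).

Let S n := psd_root (2 * n) ((A ^+ n)^T *m A ^+ n).

Lemma gram_root_spec n : (0 < n)%N ->
  psdmx (S n) /\ S n ^+ (2 * n) = (A ^+ n)^T *m A ^+ n.
Proof. by move=> n0; apply: psd_root_spec; [rewrite muln_gt0|exact: psdmx_gram]. Qed.

Lemma growth_exponential (x : 'cV[R]_d.+1) : exists r C : R, 0 < r /\
  forall k, nsq (A ^+ k *m x) <= C * (r ^+ k) ^+ 2.
Proof.
have [f f0 hf] := nsq_mulmx_le A.
(* The rate f + 1 is positive and f <= (f + 1)^2. *)
exists (f + 1), (nsq x); split=> [|k]; first lra.
elim: k => [|k IH]; first by rewrite !expr0 expr1n mulr1 mul1mx.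
have -> : A ^+ k.+1 *m x = A *m (A ^+ k *m x) by rewrite exprS mulmxA.
apply: le_trans (hf _) _.
apply: (@le_trans _ _ (f * (nsq x * ((f + 1) ^+ k) ^+ 2))); first exact: ler_wpM2l.
rewrite [_ ^+ k.+1]exprS exprMn mulrCA; apply: ler_wpM2l; first exact: nsq_ge0.
rewrite ler_wpM2r ?sqr_ge0 // expr2; have : 0 <= f * f by rewrite mulr_ge0.
lra.
Qed.

(** The upper bound at k = 1 for a basis vector controls column j of the roots uniformly in n. *)
Lemma gram_root_bounded i j : exists M, \forall n \near \oo, `|S n i j| <= M.
Proof.
have [r [C [r0 h]]] := growth_exponential (delta_mx j 0).
set K := Num.max (nsq (delta_mx j 0)) C * (r ^+ 1) ^+ 2.
(* From s^2 <= K follows |s| <= K + 1, without a square root. *)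
exists (K + 1); near=> n.
have n0 : (0 < n)%N by near: n; exact: nbhs_infty_gt.
have [[Ss _] SA] := gram_root_spec n0.
have := root_upper_bound Ss SA r0 n0 (h n); rewrite -/K expr1 => hK.
have := le_trans (sqr_entry_le_nsq _ i) hK; rewrite -colE mxE => hs.
rewrite -ler_sqr ?nnegrE ?real_normK ?num_real //; last first.
  by have := le_trans (sqr_ge0 _) hs; lra.
have := le_trans (sqr_ge0 _) hs => K0.
have := sqr_ge0 K; rewrite !expr2 in hs *; lra.
Unshelve. all: by end_near. Qed.

Section AlongFilter.
Variables (F : set_system nat) (T : 'M[R]_d.+1).
Context {FF : ProperFilter F}.
Hypotheses (Foo : \oo `<=` F) (ST : entry_cvg F S T).

Lemma limit_psd : psdmx T.
Proof.
apply: psdmx_entry_cvg ST _; apply: Foo; near=> n.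
apply: (gram_root_spec _).1; near: n; exact: nbhs_infty_gt.
Unshelve. all: by end_near. Qed.

(** At fixed k the interpolated bound holds for all large n with a constant free of n, so it passes
    to T. *)
Lemma limit_growth_sub alpha : growth_space alpha A `<=` growth_space alpha T.
Proof.
move=> x [r [C [r0 ra h]]]; exists r, (Num.max (nsq x) C); split=> // k.
apply: (cvgr_to_le (nsq_pow_cvg (k := k) (x := x) ST)); apply: Foo; near=> n.
have n0 : (0 < n)%N by near: n; exact: nbhs_infty_gt.
have [[Ss _] SA] := gram_root_spec n0.
apply: (root_upper_bound Ss SA r0 _ (h n)).
by near: n; exact: nbhs_infty_ge.
Unshelve. all: by end_near. Qed.

Lemma limit_lower_growth alpha : lower_growth alpha A `<=` lower_growth alpha T.
Proof.
move=> y hy r r0 ra; have [C h] := hy r r0 ra.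
exists (Num.max (nsq y) C) => k x.
apply: (cvgr_to_ge (cvgMr (nsq_pow_cvg (k := k) (x := x) ST))); apply: Foo; near=> n.
have n0 : (0 < n)%N by near: n; exact: nbhs_infty_gt.
have [[Ss _] SA] := gram_root_spec n0.
apply: (root_lower_bound Ss SA x r0 _ (h n)).
by near: n; exact: nbhs_infty_ge.
Unshelve. all: by end_near. Qed.

(** One inclusion passes to the limit directly. For the other, the growth space of T is orthogonal
    to the [lower_growth] of T, which contains that of A, and [lower_growth_separates] applies to
    A. *)
Lemma limit_growth alpha : 0 < alpha -> growth_space alpha T = growth_space alpha A.
Proof.
move=> a0; apply/seteqP; split=> x hx; last exact: limit_growth_sub.
rewrite -alpha_eigenspace_growth //; apply: lower_growth_separates => // y hy.
by apply: lower_growth_ortho hx _; exact: limit_lower_growth.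
Qed.

End AlongFilter.

Lemma ultra_limit (G : set_system nat) : UltraFilter G -> \oo `<=` G ->
  exists T, entry_cvg G S T.
Proof.
move=> GU Goo.
have /choice[t ht] (ij : 'I_d.+1 * 'I_d.+1) : exists l : R, (fun n => S n ij.1 ij.2) @ G --> l.
  have [M hM] := gram_root_bounded ij.1 ij.2; apply: ultra_bounded_cvg; exact: Goo hM.
exists (\matrix_(i < d.+1, j < d.+1) t (i, j)) => i j; rewrite mxE; exact: ht (i, j).
Qed.

Lemma ultra_limit_unique (G H : set_system nat) T U : UltraFilter G -> UltraFilter H ->
  \oo `<=` G -> \oo `<=` H -> entry_cvg G S T -> entry_cvg H S U -> T = U.
Proof.
move=> GU HU Goo Hoo ST SU.
apply: psd_eq_growth; [exact: limit_psd Goo ST|exact: limit_psd Hoo SU|move=> a a0].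
by rewrite (limit_growth Goo ST) // (limit_growth Hoo SU).
Qed.

Lemma roots_entry_cvg : exists T, entry_cvg \oo S T.
Proof.
have [G [GU Goo]] := @ultraFilterLemma nat \oo _.
have [T ST] := ultra_limit GU Goo.
exists T => i j V TV; apply: contrapT => nV.
(* If the entry is not eventually in [V], the n that miss [V] carry a proper filter finer than
   [\oo]; an ultrafilter above it has the same limit T, a contradiction. *)
have WF : ProperFilter (within (fun n => ~ V (S n i j)) \oo).
  apply: Build_ProperFilter_ex => B; rewrite /within /= => hB; apply: contrapT => /forallNP nB.
  apply: nV; apply: filterS hB => n hB.
  by apply: contrapT => /hB /nB.
have [H [HU Hw]] := ultraFilterLemma WF.
have Hoo : \oo `<=` H by move=> B hB; apply: Hw; apply: filterS hB => n Bn _.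
have [U SU] := ultra_limit HU Hoo.
rewrite (ultra_limit_unique GU HU Goo Hoo ST SU) in TV.
have h1 : H [set n | V (S n i j)] by exact: SU TV.
have h2 : H [set n | ~ V (S n i j)] by apply: Hw; exact: withinT.
by have [n []] := filter_ex (filterI h1 h2).
Qed.

Lemma alpha_eigenspace_Ef alpha : 0 < alpha ->
  alpha_eigenspace alpha (Ef A) = alpha_eigenspace alpha A.
Proof.
move=> a0; have [T ST] := roots_entry_cvg.
have -> : Ef A = T.
  by apply: cvg_lim; [exact: norm_hausdorff|exact: cvg_mx_entries].
by rewrite !alpha_eigenspace_growth // (limit_growth _ ST).
Qed.

End Limit.

(** No modulus is below alpha, so both sides are the span of the empty set. *)
Lemma alpha_eigenspace_le0 (R : realType) d alpha (Z Z' : 'M[R]_d) : alpha <= 0 ->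
  alpha_eigenspace alpha Z = alpha_eigenspace alpha Z'.
Proof.
move=> a0.
have noW (M : 'M[R]_d) w : ~ exists l : R[i], `|l| < alpha%:C /\ gen_eigenvector M l w.
  move=> [l [+ _]]; rewrite normc_ltE ltNge => /negP; apply.
  exact: le_trans (normc_ge0 _).
by rewrite /alpha_eigenspace; congr real_span; apply/seteqP; split=> w /noW.
Qed.

Lemma Eb_trmx (R : realType) d (A : 'M[R]_d) : Eb A = Ef A^T.
Proof.
rewrite /Eb /Ef; congr (lim (_ @ \oo)); apply/funext => n.
by rewrite -trmxX trmxK.
Qed.

Local Close Scope complex_scope.
Local Close Scope classical_set_scope.

Theorem theoremB3 (R : realType) (d : nat) (A : 'M[R]_d) (alpha : R)
    (halpha : 0 <= alpha) :
  alpha_eigenspace alpha (Ef A) = alpha_eigenspace alpha A /\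
  alpha_eigenspace alpha (Eb A) = alpha_eigenspace alpha A^T.
Proof.
have E (B : 'M[R]_d) : alpha_eigenspace alpha (Ef B) = alpha_eigenspace alpha B.
  move: halpha; rewrite le_eqVlt => /orP[/eqP <-|a0].
    exact: alpha_eigenspace_le0.
  (* [alpha_eigenspace_Ef] covers positive dimension; in dimension 0 all matrices are equal. *)
  case: d B {A} => [|n] B; last exact: alpha_eigenspace_Ef.
  by congr alpha_eigenspace; apply/matrixP => -[].
by rewrite Eb_trmx !E.
Qed.
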